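(* For each pair of integers $p\ge 3$ and $q\ge 2$, the triangle group $\Gamma=\Delta(p,q,\infty)=\langle X,Y,Z\mid X^p=Y^q=XYZ=1\rangle\cong C_p*C_q$ has uncountably many conjugacy classes of nonparabolic maximal subgroups, that is, of subgroups which are maximal (proper) subgroups of $\Gamma$ and which contain no parabolic elements of $\Gamma$.
   Context: For integers $p\ge 3$, $q\ge 2$ the group $\Delta(p,q,\infty)=\langle X,Y,Z\mid X^p=Y^q=XYZ=1\rangle$ is the free product of the cyclic groups $\langle X\rangle\cong C_p$ and $\langle Y\rangle\cong C_q$; it acts as a group of orientation-preserving isometries of the hyperbolic plane, with $X,Y$ elliptic and $Z$ parabolic. The parabolic elements of $\Gamma$ are exactly the conjugates in $\Gamma$ of the non-identity powers of $Z$. A subgroup is called nonparabolic if it contains no parabolic elements. *)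

(* Defs.v *)
From HB Require Import structures.
From mathcomp Require Import all_boot.
From mathcomp Require Import boolp classical_sets functions cardinality.

Set Implicit Arguments.
Unset Strict Implicit.
Unset Printing Implicit Defensive.

Local Open Scope quotient_scope.
Local Open Scope classical_set_scope.
Local Open Scope group_scope.

Section Presentation.
Variables (I : choiceType) (R : set (seq (I * bool))).

(* The letter (i, false) stands for the generator i, (i, true) for its
   formal inverse; R is the set of relators. *)
Definition inv_letter (a : I * bool) := (a.1, ~~ a.2).
Definition inv_word (w : seq (I * bool)) := rev (map inv_letter w).

(* The smallest congruence on words making letters invertible and killing
   the relators: u ~ v iff u and v are equal in < I | R >. *)
Inductive word_cong : seq (I * bool) -> seq (I * bool) -> Prop :=
| word_cong_refl u : word_cong u u
| word_cong_sym u v : word_cong u v -> word_cong v u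
| word_cong_trans v u w : word_cong u v -> word_cong v w -> word_cong u w
| word_cong_cat u u' v v' :
    word_cong u u' -> word_cong v v' -> word_cong (u ++ v) (u' ++ v')
| word_cong_inv a : word_cong [:: a; inv_letter a] [::]
| word_cong_rel r : R r -> word_cong r [::].

Definition word_rel : rel (seq (I * bool)) := fun u v => `[< word_cong u v >].

Lemma word_rel_refl : reflexive word_rel.
Proof. by move=> u; apply/asboolP; exact: word_cong_refl. Qed.

Lemma word_rel_sym : symmetric word_rel.
Proof.
by move=> u v; apply/asboolP/asboolP => ?; exact: word_cong_sym.
Qed.

Lemma word_rel_trans : transitive word_rel.
Proof.
move=> v u w /asboolP uv /asboolP vw; apply/asboolP.
exact: word_cong_trans uv vw.
Qed.

Canonical word_equiv :=
  EquivRel word_rel word_rel_refl word_rel_sym word_rel_trans.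

Definition presented := {eq_quot word_equiv}.

HB.instance Definition _ : EqQuotient _ word_equiv presented :=
  EqQuotient.on presented.
HB.instance Definition _ := Choice.on presented.

Lemma pres_eqP u v : word_cong u v <-> \pi_presented u = \pi_presented v.
Proof.
split=> [uv|/eqmodP/asboolP //].
by apply/eqmodP/asboolP.
Qed.

Lemma inv_letterK : involutive inv_letter.
Proof. by case=> i b; rewrite /inv_letter /= negbK. Qed.

Lemma inv_wordK : involutive inv_word.
Proof.
move=> w; rewrite /inv_word map_rev revK -map_comp -[RHS]map_id.
by apply: eq_map => a; exact: inv_letterK.
Qed.

Lemma word_cong_mulV w : word_cong (w ++ inv_word w) [::].
Proof.
elim: w => [|a w IHw]; first exact: word_cong_refl.
rewrite /inv_word /= rev_cons -cats1 catA -/(inv_word w).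
have : word_cong ([:: a] ++ ((w ++ inv_word w) ++ [:: inv_letter a]))
                 ([:: a] ++ ([::] ++ [:: inv_letter a])).
  by do ![apply: word_cong_cat => //; try exact: word_cong_refl].
by move/word_cong_trans; apply; exact: word_cong_inv.
Qed.

Lemma word_cong_mulVl w : word_cong (inv_word w ++ w) [::].
Proof. by rewrite -{2}(inv_wordK w); exact: word_cong_mulV. Qed.

Lemma word_cong_inv_word u v :
  word_cong u v -> word_cong (inv_word u) (inv_word v).
Proof.
move=> uv; apply: (word_cong_trans (v := inv_word u ++ (v ++ inv_word v))).
  rewrite -{1}[inv_word u]cats0; apply: word_cong_cat.
    exact: word_cong_refl.
  exact/word_cong_sym/word_cong_mulV.
rewrite catA -{2}[inv_word v]cat0s; apply: word_cong_cat.
  apply: word_cong_trans (word_cong_mulVl u).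
  by apply: word_cong_cat; [exact: word_cong_refl | exact: word_cong_sym].
exact: word_cong_refl.
Qed.

Definition pres_one : presented := \pi_presented [::].
Definition pres_mul (x y : presented) : presented := \pi_presented (repr x ++ repr y).
Definition pres_inv (x : presented) : presented := \pi_presented (inv_word (repr x)).

Lemma repr_pi_cong w : word_cong (repr (\pi_presented w)) w.
Proof. by apply/pres_eqP; rewrite reprK. Qed.

Lemma pres_mulE u v :
  pres_mul (\pi_presented u) (\pi_presented v) = \pi_presented (u ++ v).
Proof. by apply/pres_eqP/word_cong_cat; exact: repr_pi_cong. Qed.

Lemma pres_invE u : pres_inv (\pi_presented u) = \pi_presented (inv_word u).
Proof. by apply/pres_eqP/word_cong_inv_word/repr_pi_cong. Qed.

Lemma pres_mulA : associative pres_mul.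
Proof.
elim/quotW => u; elim/quotW => v; elim/quotW => w.
by rewrite (pres_mulE v w) (pres_mulE u) (pres_mulE u v) pres_mulE catA.
Qed.

Lemma pres_mul1 : left_id pres_one pres_mul.
Proof. by elim/quotW => u; rewrite /pres_one pres_mulE. Qed.

Lemma pres_mulr1 : right_id pres_one pres_mul.
Proof. by elim/quotW => u; rewrite /pres_one pres_mulE cats0. Qed.

Lemma pres_mulV : left_inverse pres_one pres_inv pres_mul.
Proof.
elim/quotW => u; rewrite pres_invE pres_mulE.
exact/pres_eqP/word_cong_mulVl.
Qed.

Lemma pres_mulrV : right_inverse pres_one pres_inv pres_mul.
Proof.
elim/quotW => u; rewrite pres_invE pres_mulE.
exact/pres_eqP/word_cong_mulV.
Qed.

HB.instance Definition _ := isGroup.Build presented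
  pres_mulA pres_mul1 pres_mulr1 pres_mulV pres_mulrV.

Definition pres_gen (i : I) : presented := \pi_presented [:: (i, false)].

End Presentation.

Section Subgroups.
Variable G : groupType.
Implicit Types H K M : set G.

Definition is_subgroup H := group_closed [in H].

Definition maximal_subgroup M :=
  [/\ is_subgroup M, M <> setT &
      forall K, is_subgroup K -> M `<=` K -> K = M \/ K = setT].

Definition conj_subset H (g : G) : set G := [set h ^ g | h in H].

Definition conj_class H : set (set G) := [set conj_subset H g | g in setT].

End Subgroups.

Definition iX : 'I_3 := @Ordinal 3 0 isT.
Definition iY : 'I_3 := @Ordinal 3 1 isT.
Definition iZ : 'I_3 := @Ordinal 3 2 isT.

Definition triangle_relators (p q : nat) : set (seq ('I_3 * bool)) :=
  [set nseq p (iX, false); nseq q (iY, false);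
       [:: (iX, false); (iY, false); (iZ, false)]].

(* < X, Y, Z | X^p = Y^q = XYZ = 1 > *)
Definition triangle (p q : nat) : groupType :=
  presented (triangle_relators p q).

Definition genZ (p q : nat) : triangle p q :=
  pres_gen (triangle_relators p q) iZ.

(* Z ^+ n and Z ^- n with n : nat cover all the integer powers of Z; the
   parabolic isometries in the group are the conjugates of the nontrivial
   ones. *)
Definition parabolic (p q : nat) : set (triangle p q) :=
  [set g | exists (n : nat) (c : triangle p q), genZ p q ^+ n != 1 /\
     (g = (genZ p q ^+ n) ^ c \/ g = (genZ p q ^- n) ^ c)].

Definition nonparabolic (p q : nat) (H : set (triangle p q)) :=
  H `&` @parabolic p q = set0.

(* Main.v *)
Require Import Defs.
From mathcomp Require Import all_boot ssralg ssrnum ssrint zify.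
From mathcomp Require Import boolp classical_sets functions cardinality.

Set Implicit Arguments.
Unset Strict Implicit.
Unset Printing Implicit Defensive.

Local Open Scope classical_set_scope.

(** The maximal subgroups are point stabilizers of actions on the integers in
which Z is the translation x |-> x + 1.  Such an action is given by a single
map f, the action of Y: the relation XYZ = 1 forces X to act as the inverse of
succf : x |-> f x + 1, so all that is required is that f and succf have orders
dividing q and p.  Since Z acts regularly, no conjugate of a nontrivial power
of Z has a fixed point, hence the stabilizer of 0 is nonparabolic
([stab_nonparabolic]).  Blocks of imprimitivity are in particular invariant
under the translation, so they are the classes modulo a subgroup D of the
integers, and the stabilizer is maximal as soon as f preserves no congruence
other than the two trivial ones ([stab_maximal]).  Two stabilizers are
conjugate only if the corresponding maps f are conjugate under a translation
([conj_class_stab]).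

It remains to find enough maps f.  Picture a one-ended plane tree whose
vertices are the cycles of X and Y, with the integers labelling the successive
corners met when walking around it.  The nonpositive integers label one side of
the infinite branch and the positive ones the other.  On the positive side, at
each level k one free choice is made: hang there a fixed point of Y (one
corner) or a full q-cycle of Y (q corners).  A 0-1 sequence b records the
choices and [rotation] is the resulting f; its cycles are visible from the
construction ([iter_rotation], [iter_succf_rotation]).

If f preserves congruence modulo n > 0, comparing the values of f at -k and
-(k + n) shows that the sizes of the choices at the levels k and k + n agree
modulo n.  So if b is not periodic, n divides q - 1; then the choices become
invisible modulo n, and two consecutive levels already force n = 1
([rotation_primitive]).  Finally 0 is the least fixed point of f, so that no
nontrivial translation relates two of these maps, and f determines b
([rotation_translate_inj]).  There are uncountably many non-periodic b, whence
the theorem by the diagonal argument. *)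

(** * Subgroups, cycles and a diagonal argument *)

Lemma subgroupP (G : groupType) (H : set G) : is_subgroup H ->
  [/\ H 1%g, forall x y, H x -> H y -> H (x * y)%g & forall x, H x -> H x^-1%g].
Proof.
move=> Hgrp; have HV := group_closedV Hgrp; have HM := group_closedM Hgrp.
split=> [|x y /mem_set Hx /mem_set Hy|x /mem_set Hx]; apply: set_mem.
- by case: Hgrp.
- exact: HM.
- exact: HV.
Qed.

Lemma iter_cycle T (h : T -> T) (s : nat -> T) n :
  (forall i, i < n -> h (s i) = s i.+1) -> h (s n) = s 0 ->
  forall i, i <= n -> iter n.+1 h (s i) = s i.
Proof.
move=> hs hsn; have iter_s i : i <= n -> iter i h (s 0) = s i.
  by elim: i => //= i IHi lt_in; rewrite IHi ?hs // ltnW.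
move=> i le_in; rewrite -(iter_s i le_in) -iterD addnC iterD /=.
by rewrite iter_s // hsn.
Qed.

Lemma succ_iter_pred T (h : T -> T) n x : 0 < n ->
  h (iter n.-1 h x) = iter n h x /\ iter n.-1 h (h x) = iter n h x.
Proof. by case: n => // n _; rewrite -iterSr. Qed.

(** Cantor's argument: a numbering [h] of the values of [F] is contradicted by
the sequence that differs at [h (F a)] from [a]. *)
Lemma not_countable_of_sequences T (A : set T) (F : (nat -> bool) -> T) :
  (forall a, A (F a)) -> (forall a a', F a = F a' -> a =1 a') -> ~ countable A.
Proof.
move=> AF F_inj /countable_injP[h h_inj].
pose diag n := `[< exists2 a, h (F a) = n & ~~ a n >].
have [diag_n|ndiag_n] := boolP (diag (h (F diag))).
  have /asboolP[a haE /negP] := diag_n; apply.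
  by rewrite (F_inj _ _ (h_inj _ _ _ _ haE)) //; exact/mem_set/AF.
by have /asboolP := ndiag_n; apply; exists diag.
Qed.

(** * Actions on the integers in which Z is the translation by 1 *)

Section IntegerAction.
Variables (p q : nat) (f : int -> int).
Hypothesis p_gt0 : 0 < p.
Hypothesis q_gt0 : 0 < q.

Local Definition succf (x : int) : int := (f x + 1)%R.

Hypothesis iter_f : forall x, iter q f x = x.
Hypothesis iter_succf : forall x, iter p succf x = x.

Local Notation G := (triangle p q).
Local Notation relators := (triangle_relators p q).
Local Notation gY := (pres_gen relators iY).
Local Notation gZ := (genZ p q).

(** Words act on the right, letter by letter, so that the first letter of a word
acts first.  X is the inverse of [succf], written as a power of it. *)
Definition letter_act (x : int) (a : 'I_3 * bool) : int :=
  match val a.1, a.2 with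
  | 0, false => iter p.-1 succf x
  | 0, true => succf x
  | 1, false => f x
  | 1, true => iter q.-1 f x
  | _, false => (x + 1)%R
  | _, true => (x - 1)%R
  end.

Definition word_act (x : int) (w : seq ('I_3 * bool)) : int :=
  foldl letter_act x w.

Lemma letter_actK x a : letter_act (letter_act x a) (inv_letter a) = x.
Proof.
case: a => -[[|[|[|//]]] lt_i] [] /=; rewrite /letter_act /=; try lia.
- by rewrite (succ_iter_pred _ _ p_gt0).2.
- by rewrite (succ_iter_pred _ _ p_gt0).1.
- by rewrite (succ_iter_pred _ _ q_gt0).1.
- by rewrite (succ_iter_pred _ _ q_gt0).2.
Qed.

Lemma word_act_nseq n a x :
  word_act x (nseq n a) = iter n (fun y => letter_act y a) x.
Proof. by elim: n x => //= n IHn x; rewrite IHn -iterSr. Qed.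

Lemma word_act_cong u v : word_cong relators u v ->
  forall x, word_act x u = word_act x v.
Proof.
elim=> {u v} [//|u v _ uv x|v u w _ uv _ vw x|u u' v v' _ uu' _ vv' x
  |a x|r r_rel x].
- by rewrite uv.
- by rewrite uv.
- by rewrite /word_act !foldl_cat -!/(word_act _ _) uu' vv'.
- exact: letter_actK.
- case: r_rel => [[->|->]|->].
  + rewrite word_act_nseq /letter_act /=.
    by rewrite -iterM mulnC iterM iter_fix.
  + by rewrite word_act_nseq.
  + rewrite -[LHS]/(succf (iter p.-1 succf x)).
    by rewrite (succ_iter_pred succf x p_gt0).1.
Qed.

Definition act (x : int) (g : G) : int := word_act x (repr g).

Lemma act_pi x w : act x (\pi_(presented relators)%qT w) = word_act x w.
Proof. exact/word_act_cong/repr_pi_cong. Qed.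

Lemma act1 x : act x 1%g = x.
Proof. by rewrite act_pi. Qed.

Lemma actM x g h : act x (g * h)%g = act (act x g) h.
Proof. by rewrite act_pi /word_act foldl_cat. Qed.

Lemma actK g x : act (act x g) g^-1%g = x.
Proof. by rewrite -actM mulgV act1. Qed.

Lemma actKV g x : act (act x g^-1%g) g = x.
Proof. by rewrite -actM mulVg act1. Qed.

Lemma act_genY x : act x gY = f x.
Proof. by rewrite act_pi. Qed.

Lemma act_genZ x : act x gZ = (x + 1)%R.
Proof. by rewrite act_pi. Qed.

Lemma act_genZX x n : act x (gZ ^+ n)%g = (x + n%:Z)%R.
Proof.
elim: n x => [|n IHn] x; first by rewrite act1 GRing.addr0.
by rewrite expgS actM act_genZ IHn; lia.
Qed.

Definition powZ (j : int) : G :=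
  match j with Posz n => gZ ^+ n | Negz n => gZ ^- n.+1 end%g.

Lemma act_powZ x j : act x (powZ j) = (x + j)%R.
Proof.
case: j => n; first exact: act_genZX.
have := actKV (gZ ^+ n.+1)%g x; rewrite act_genZX /=; lia.
Qed.

Lemma act_powZV x j : act x (powZ j)^-1%g = (x - j)%R.
Proof. have := actKV (powZ j) x; rewrite act_powZ; lia. Qed.

Definition stab : set G := [set g | act 0%R g = 0%R].

Lemma stab_subgroup : is_subgroup stab.
Proof.
split; first by apply: mem_set; exact: act1.
move=> g h /set_mem g0 /set_mem h0; apply: mem_set.
by rewrite /stab /= actM g0 -[X in act X _]h0 actK.
Qed.

(** A parabolic element acts as a translation by some nonzero n, seen through
the change of coordinates given by the conjugating element [c], and such a map
has no fixed point. *)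
Lemma stab_nonparabolic : nonparabolic stab.
Proof.
apply/seteqP; split=> // g [g0 [n [c [Zn_neq1 g_conj]]]].
have act_conj (k : int) (z : G) : (forall x, act x z = (x + k)%R) ->
    act 0%R (z ^ c)%g = 0%R -> k = 0%R.
  move=> zE; rewrite conjgE !actM zE => /(congr1 (act^~ c^-1%g)).
  by rewrite actK; move: (act 0%R _) => y; lia.
suff n0 : n = 0 by rewrite n0 expg0 eqxx in Zn_neq1.
have ZVn x : act x (gZ ^- n)%g = (x - n%:Z)%R.
  have := actKV (gZ ^+ n)%g x; rewrite act_genZX; lia.
move: g0; rewrite /stab /=.
case: g_conj => -> /act_conj; first by move/(_ _ (act_genZX^~ n)); lia.
by move/(_ _ ZVn); lia.
Qed.

(** Let [K] contain the stabilizer.  As Z is transitive, membership in [K]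
depends only on the image of 0, so [K] is determined by the set [D] of the j
with Z^j in [K].  This [D] is a subgroup of the integers, and f preserves
congruence modulo [D] because Z^x Y Z^(- f x) fixes 0.  The hypothesis says that
an f-invariant [D] is 0 or everything, that is, that [K] is the stabilizer or
the whole group. *)
Lemma stab_maximal :
  (forall D : set int, D 0%R ->
     (forall x y, D x -> D y -> D (x - y)%R) ->
     (forall x y : int, D (x - y)%R -> D (f x - f y)%R) ->
     (exists2 x, D x & x <> 0%R) -> D 1%R) ->
  maximal_subgroup stab.
Proof.
move=> primitive; split; first exact: stab_subgroup.
  move=> stabT; have : stab gZ by rewrite stabT.
  by rewrite /stab /= act_genZ.
move=> K K_grp stabK; have [K1 KM KV] := subgroupP K_grp.
have K_act g h : act 0%R g = act 0%R h -> K h -> K g.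
  move=> gh Kh; rewrite -(mulgVK h g); apply: KM => //.
  by apply: stabK; rewrite /stab /= actM gh actK.
pose D : set int := [set j | K (powZ j)].
have KD g : K g <-> D (act 0%R g).
  by split; apply: K_act; rewrite act_powZ GRing.add0r.
have D0 : D 0%R by exact: K1.
have DB (x y : int) : D x -> D y -> D (x - y)%R.
  move=> Dx Dy; have /KD : K (powZ x * (powZ y)^-1)%g.
    by apply: KM => //; exact: KV.
  by rewrite actM act_powZ act_powZV GRing.add0r.
have Df (x y : int) : D (x - y)%R -> D (f x - f y)%R.
  move=> Dxy.
  have stabY z : K (powZ z * gY * (powZ (f z))^-1)%g.
    apply: stabK; rewrite /stab /= !actM act_powZ act_genY act_powZV.
    by rewrite GRing.add0r GRing.subrr.
  have Kxy : K (powZ x * (powZ y)^-1)%g.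
    by apply/KD; rewrite actM act_powZ act_powZV GRing.add0r.
  (* the product telescopes to Z^(f x) Z^(- f y) *)
  have /KD := KM _ _ (KM _ _ (KV _ (stabY x)) Kxy) (stabY y).
  rewrite !invgM invgK !mulgA mulgVK mulgVK mulgVK.
  by rewrite actM act_powZ act_powZV GRing.add0r.
have [nontriv|triv] := pselect (exists2 x, D x & x <> 0%R).
  right; have D1 := primitive D D0 DB Df nontriv.
  have DV x : D x -> D (- x)%R.
    by move=> Dx; rewrite -GRing.sub0r; exact: DB.
  have Dn (n : nat) : D (n : int).
    elim: n => // n Dn.
    by have := DB _ _ Dn (DV _ D1); congr D; lia.
  apply/seteqP; split=> // g _; apply/KD.
  by case: (act 0%R g) => n; [exact: Dn|rewrite NegzE; exact/DV/Dn].
left; apply/seteqP; split=> // g Kg; rewrite /stab /=.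
apply: contrapT => g0; apply: triv.
by exists (act 0%R g) => //; exact: (KD g).1.
Qed.

Lemma conj_stab c :
  conj_subset stab c = [set g | act (act 0%R c) g = act 0%R c].
Proof.
apply/seteqP; split=> [_ [g g0 <-]|g gc] /=.
  by rewrite conjgE !actM actK g0.
exists (g ^ c^-1)%g; last by rewrite conjgKV.
by rewrite /stab /= conjgE invgK !actM gc actK.
Qed.

End IntegerAction.

(** The second stabilizer is the stabilizer of some point [j] in the first
action, so an element fixes 0 in the second action exactly when it fixes [j] in
the first one.  Applied to Z^x Y Z^(- f' x), this reads off [f' x]. *)
Lemma conj_class_stab p q (f f' : int -> int) :
  0 < p -> 0 < q ->
  (forall x, iter q f x = x) -> (forall x, iter p (succf f) x = x) ->
  (forall x, iter q f' x = x) -> (forall x, iter p (succf f') x = x) ->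
  conj_class (stab (p:=p) (q:=q) f) = conj_class (stab f') ->
  exists j, forall x, f' x = (f (x + j) - j)%R.
Proof.
move=> p_gt0 q_gt0 fq fp f'q f'p same.
have : conj_class (stab (p:=p) (q:=q) f') (stab f').
  exists 1%g => //; rewrite conj_stab //.
  by rewrite act1.
rewrite -same => -[c _]; rewrite conj_stab //.
move: (act _ _ c) => j stabE; exists j => x.
pose g : triangle p q := (powZ p q x * pres_gen (triangle_relators p q) iY *
                          (powZ p q (f' x))^-1)%g.
have : stab f' g.
  rewrite /stab /= !actM // act_powZ // act_genY // act_powZV //.
  by rewrite GRing.add0r GRing.subrr.
rewrite -stabE /= !actM // act_powZ // act_genY // act_powZV //.
by rewrite [(j + x)%R]GRing.addrC; move: (f _) (f' x); lia.
Qed.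

(** * The permutation attached to a sequence of choices *)

Section Construction.
(* In this section p is d + 3 and q is e + 2. *)
Variables (d e : nat) (b : nat -> bool).

Definition block (k : nat) : nat := if b k then e.+2 else 1.

(** Level k of the positive side is the interval from [start k] to
[start k.+1 - 1].  It consists of the chosen block, of d = p - 3 fixed points
that complete a cycle of X to length p, and of e + 1 = q - 1 points forming a
q-cycle of Y with the integer -(k + 1), which leads to the next level. *)
Fixpoint start (k : nat) : nat :=
  if k is k'.+1 then start k' + block k' + d + e.+1 else 1.

(** The index of the level containing n, for n > 0; the value at 0 is a
default. *)
Fixpoint level (n : nat) : nat :=
  if n is n'.+1 then
    if n == start (level n').+1 then (level n').+1 else level n'
  else 0.

(** Every cycle is traversed in decreasing order, its least element being sent
to its greatest.  With this orientation f x = x - 1 for most points of a cycle of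
f, and these are the fixed points of [succf]; the other ones form, for each
level, a single cycle of [succf]. *)
Definition rotation (x : int) : int :=
  match x with
  | Negz m => ((start m.+1 : int) - 1)%R
  | Posz 0 => 0%R
  | Posz n =>
    let k := level n in
    if n == start k then ((start k + block k)%N%:Z - 1)%R
    else if n < start k + block k then (n%:Z - 1)%R
    else if n < start k + block k + d then (n%:Z)%R
    else if n == start k + block k + d then (- (k.+1 : int))%R
    else (n%:Z - 1)%R
  end.

Local Notation f := rotation.

Lemma block_gt0 k : 0 < block k. Proof. by rewrite /block; case: ifP. Qed.

Lemma startS k : start k.+1 = start k + block k + d + e.+1. Proof. by []. Qed.

Lemma start_gt0 k : 0 < start k. Proof. by case: k => //= k; lia. Qed.

Lemma start_ltS k : start k < start k.+1.
Proof. by rewrite startS; lia. Qed.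

Lemma start_mono : {mono start : m n / m <= n}.
Proof.
by apply: leq_mono => m n; apply: (homo_ltn (@ltn_trans)); exact: start_ltS.
Qed.

Lemma level_bounds n : 0 < n -> start (level n) <= n < start (level n).+1.
Proof.
elim: n => // -[_ _|n /(_ isT) IHn _].
  have lt1 : 1 < start 1 by exact: (start_ltS 0).
  by rewrite -[level 1]/(if 1 == start 1 then 1 else 0) ifN ?lt1 // neq_ltn lt1.
have -> : level n.+2 =
    if n.+2 == start (level n.+1).+1 then (level n.+1).+1 else level n.+1 by [].
move: (level n.+1) IHn => l IHn.
by case: eqP => [->|]; [rewrite leqnn start_ltS | lia].
Qed.

Lemma level_uniq k n : start k <= n < start k.+1 -> level n = k.
Proof.
move=> kn; have /level_bounds ln : 0 < n by have := start_gt0 k; lia.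
apply/eqP; rewrite eqn_leq -ltnS -[X in _ && X]ltnS.
by rewrite -(leqW_mono start_mono) -[X in _ && X](leqW_mono start_mono); lia.
Qed.

Lemma rotation_opp (k : nat) : f (- (k : int))%R = ((start k : int) - 1)%R.
Proof.
by case: k => [|k]; rewrite ?GRing.oppr0 -?NegzE /=; lia.
Qed.

Lemma rotation_pos (k n : nat) : start k <= n < start k.+1 -> f n =
  if n == start k then ((start k + block k)%N%:Z - 1)%R
  else if n < start k + block k then (n%:Z - 1)%R
  else if n < start k + block k + d then (n%:Z)%R
  else if n == start k + block k + d then (- (k.+1 : int))%R
  else (n%:Z - 1)%R.
Proof.
move=> kn; rewrite -(level_uniq kn) /f; case: n kn => // kn.
by have := start_gt0 k; lia.
Qed.

Lemma rotation_block (k : nat) : f (start k) = ((start k + block k)%N%:Z - 1)%R.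
Proof.
by rewrite (@rotation_pos k) ?eqxx // leqnn start_ltS.
Qed.

Lemma rotation_inside_block (k n : nat) : start k < n < start k + block k ->
  f n = ((n : int) - 1)%R.
Proof.
move=> kn; rewrite (@rotation_pos k) ?startS; last lia.
by case: eqP; [lia|case: ifP; lia].
Qed.

Lemma rotation_fixed (k n : nat) :
  start k + block k <= n < start k + block k + d ->
  f n = n.
Proof.
have := block_gt0 k => ik kn; rewrite (@rotation_pos k) ?startS; last lia.
case: eqP => [|_]; first lia.
by do 2![case: ifP; try lia].
Qed.

Lemma rotation_wrap (k : nat) :
  f (start k + block k + d)%N = (- (k.+1 : int))%R.
Proof.
have ik := block_gt0 k; rewrite (@rotation_pos k) ?startS; last lia.
case: eqP => [|_]; first lia.
by do 2![case: ifP => [|_]; first lia]; rewrite eqxx; lia.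
Qed.

Lemma rotation_inside_wrap (k n : nat) :
  start k + block k + d < n < start k.+1 ->
  f n = ((n : int) - 1)%R.
Proof.
rewrite startS => kn; rewrite (@rotation_pos k) ?startS; last lia.
case: eqP => [|_]; first lia.
by do 2![case: ifP => [|_]; first lia]; case: ifP; lia.
Qed.

(** The nontrivial cycles of f are the chosen q-cycles and those joining the end
of a level to a negative integer. *)
Lemma iter_rotation x : iter e.+2 f x = x.
Proof.
(* the q-cycle leaving level k, listed from the negative integer on, which is
   followed by the end of the level *)
have wrap k i : i <= e.+1 -> let s i : int :=
    (if i is j.+1 then (start k.+1 : int) - (j.+1 : int)
     else - (k.+1 : int))%R in
    iter e.+2 f (s i) = s i.
  move=> le_i s; apply: (@iter_cycle _ f s) le_i => {i} [[|i] lt_i|].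
  - by rewrite /s rotation_opp.
  - have -> : s i.+1 = (start k.+1 - i.+1)%N by rewrite /s startS; lia.
    by rewrite (@rotation_inside_wrap k) /s startS; lia.
  - have -> : s e.+1 = (start k + block k + d)%N by rewrite /s startS; lia.
    exact: rotation_wrap.
case: x => [[|n]|m]; last by rewrite NegzE; exact: (wrap m 0).
  by rewrite iter_fix.
set N := n.+1; have /level_bounds := ltn0Sn n; rewrite -/N.
move: (level N) => k kN.
have [ltN|geN] := ltnP N (start k + block k).
  have [b_k|nb_k] := boolP (b k); last first.
    have -> : N = start k by move: ltN; rewrite /block ifN //; lia.
    rewrite iter_fix // rotation_block /block ifN //; lia.
  pose s i : int := ((start k + e.+1 : int) - (i : int))%R.
  have ik : block k = e.+2 by rewrite /block b_k.
  have -> : (N : int) = s (start k + e.+1 - N) by rewrite /s; lia.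
  apply: (@iter_cycle _ f s); last by lia.
  - move=> i lt_i; have -> : s i = (start k + e.+1 - i)%N by rewrite /s; lia.
    by rewrite (@rotation_inside_block k) /s; lia.
  - have -> : s e.+1 = start k by rewrite /s; lia.
    by rewrite rotation_block /s; lia.
have [lt_dN|ge_dN] := ltnP N (start k + block k + d).
  by rewrite iter_fix // (@rotation_fixed k) ?geN.
have [j jN] : exists j, start k.+1 - N = j.+1.
  by exists (start k.+1 - N).-1; lia.
have -> : (N : int) = ((start k.+1 : int) - (j.+1 : int))%R by lia.
by apply: (wrap k j.+1); move: jN; rewrite startS; lia.
Qed.

(** The nontrivial cycles of [succf] are, one for each k,
- k |-> start k |-> start k + block k |-> ... |-> start k + block k + d |-> - k,
where the steps in the middle are by 1; the length is d + 3. *)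
Lemma iter_succf_rotation x : iter d.+3 (succf f) x = x.
Proof.
pose s (k i : nat) : int :=
  (match i with 0 => - (k : int) | 1 => start k : int
           | j.+2 => (start k + block k + j)%N : int end)%R.
have cycle (k i : nat) : i <= d.+2 -> iter d.+3 (succf f) (s k i) = s k i.
  move=> le_i; apply: iter_cycle le_i => {i} [[|[|i]] lt_i|].
  - by rewrite /succf /s rotation_opp; lia.
  - by rewrite /succf /s rotation_block; lia.
  - by rewrite /succf /s (@rotation_fixed k); lia.
  - by rewrite /succf /s rotation_wrap; lia.
case: x => [[|n]|m]; last by rewrite NegzE; exact: (cycle m.+1 0).
  exact: (cycle 0 0).
set N := n.+1; have /level_bounds := ltn0Sn n; rewrite -/N.
move: (level N) => k kN.
have [->|neqN] := eqVneq N (start k); first exact: (cycle k 1).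
have [ltN|geN] := ltnP N (start k + block k).
  by rewrite iter_fix // /succf (@rotation_inside_block k); lia.
have [le_dN|gt_dN] := leqP N (start k + block k + d).
  have -> : (N : int) = s k (N - (start k + block k)).+2 by rewrite /s; lia.
  by apply: cycle; lia.
by rewrite iter_fix // /succf (@rotation_inside_wrap k); lia.
Qed.

(** For n > 0 in [D], the values [start k - 1] of f at - k show that
[block (k + n) - block k] is in [D]; it is 0 or plus or minus q - 1, and is not
always 0, so q - 1 is in [D].  Modulo [D] the start of level k + 1 is then
congruent to the point of level k that f sends to - (k + 1), and f fixes it up
to [D]: hence [start k.+1] is congruent to - (k + 1).  The case k = 0 says
that p is in [D], and the difference with the case k = 1 that p - 1 is. *)
Lemma rotation_primitive (D : set int) :
  (forall n, 0 < n -> exists k, b (k + n) != b k) ->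
  D 0%R -> (forall x y, D x -> D y -> D (x - y)%R) ->
  (forall x y : int, D (x - y)%R -> D (f x - f y)%R) ->
  (exists2 x, D x & x <> 0%R) -> D 1%R.
Proof.
move=> b_aper D0 DB Df [x Dx x_neq0].
have DV y : D y -> D (- y)%R by move=> Dy; rewrite -GRing.sub0r; exact: DB.
have DD y z : D y -> D z -> D (y + z)%R.
  by move=> Dy /DV Dz; rewrite -[z]GRing.opprK; exact: DB.
have [n n_gt0 Dn] : exists2 n, 0 < n & D (n : int).
  exists `|x|%N; first by lia.
  have [x_ge0|x_le0] : (x = `|x|%N \/ - x = `|x|%N :> int)%R by lia.
    by rewrite -x_ge0.
  by rewrite -x_le0; exact: DV.
have D_start k : D ((start (k + n) : int) - (start k : int))%R.
  have := @Df (- ((k + n)%N : int))%R (- (k : int))%R.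
  rewrite !rotation_opp => D_f.
  have -> : ((start (k + n) : int) - (start k : int) =
      ((start (k + n) : int) - 1) - ((start k : int) - 1))%R by lia.
  by apply: D_f; have := DV _ Dn; congr D; lia.
have D_block k : D ((block (k + n) : int) - (block k : int))%R.
  have := DB _ _ (D_start k.+1) (D_start k); rewrite addSn !startS.
  by congr D; lia.
have De : D (e.+1 : int).
  have [k] := b_aper n n_gt0; have := D_block k; rewrite /block.
  case: (b (k + n)); case: (b k) => // D_e _.
  by move: (DV _ D_e); congr D; lia.
have D_block1 k : D ((block k : int) - 1)%R.
  by rewrite /block; case: (b k); [move: De | move: D0]; congr D; lia.
have D_start_level k : D ((start k.+1 : int) + (k.+1 : int))%R.
  have := @Df (start k.+1) (start k + block k + d)%N.
  rewrite rotation_block rotation_wrap => D_f.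
  have D_e : D ((start k.+1 : int) - ((start k + block k + d)%N : int))%R.
    by move: De; rewrite startS; congr D; lia.
  have := DB _ _ (D_f D_e) (D_block1 k.+1); congr D; lia.
have Dp : D (d.+3 : int).
  have := DB _ _ (DB _ _ (D_start_level 0) (D_block1 0)) De.
  by rewrite startS /=; congr D; lia.
have Dp1 : D (d.+2 : int).
  have := DB _ _ (D_start_level 1) (D_start_level 0).
  move/DB/(_ (DD _ _ (D_block1 1) De)).
  by rewrite (startS 1); congr D; lia.
by have := DB _ _ Dp Dp1; congr D; lia.
Qed.

Lemma rotation_fixed_ge0 x : f x = x -> (0 <= x)%R.
Proof.
case: x => // m; rewrite NegzE rotation_opp; have := start_gt0 m.+1; lia.
Qed.

End Construction.

(** The integer 0 is the least fixed point of both maps, so [j = 0].  The values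
at - k then give back the starts of the levels, hence the sizes of the
blocks. *)
Lemma rotation_translate_inj d e b b' (j : int) :
  (forall x, rotation d e b' x = (rotation d e b (x + j) - j)%R) -> b' =1 b.
Proof.
move=> bj.
have j_ge0 : (0 <= j)%R.
  apply: (@rotation_fixed_ge0 d e b).
  by have := bj 0%R; rewrite GRing.add0r [LHS]/=; move: (rotation _ _ _ j); lia.
have j_le0 : (0 <= - j)%R.
  apply: (@rotation_fixed_ge0 d e b').
  by rewrite bj GRing.addNr GRing.sub0r.
have {bj} j0 x : rotation d e b' x = rotation d e b x.
  have j_eq0 : j = 0%R by lia.
  by rewrite bj j_eq0 GRing.addr0 GRing.subr0.
have startE k : start d e b' k = start d e b k.
  by have := j0 (- (k : int))%R; rewrite !rotation_opp; lia.
move=> k; have := startE k.+1; rewrite !startS startE /block.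
by case: (b k); case: (b' k); lia.
Qed.

(** * Uncountably many choices *)

(** Every sequence is turned into a non-periodic one: the value at 0 is true,
while all the other even positions carry false. *)
Definition spread (a : nat -> bool) (k : nat) : bool :=
  (k == 0) || (odd k && a k./2).

Lemma spread_aperiodic a n : 0 < n -> exists k, spread a (k + n) != spread a k.
Proof.
move=> n_gt0; have [neq|] := boolP (spread a (0 + n) != spread a 0).
  by exists 0.
rewrite negbK => /eqP a_n; exists n; rewrite a_n.
by rewrite /spread addnn odd_double /= orbF double_eq0; case: n n_gt0 {a_n}.
Qed.

Lemma spread_inj a a' : spread a =1 spread a' -> a =1 a'.
Proof.
move=> eq_a n; have := eq_a n.*2.+1.
by rewrite /spread /= odd_double /= uphalf_double.
Qed.

Theorem theorem1 (p q : nat) (hp : (3 <= p)%N) (hq : (2 <= q)%N) :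
  ~ countable [set conj_class M | M in
      [set M : set (triangle p q) | maximal_subgroup M /\ nonparabolic M]].
Proof.
case: p hp => [|[|[|d]]] // _; case: q hq => [|[|e]] // _.
pose f a := rotation d e (spread a).
have fq a x : iter e.+2 (f a) x = x by exact: iter_rotation.
have fp a x : iter d.+3 (succf (f a)) x = x by exact: iter_succf_rotation.
apply: (@not_countable_of_sequences _ _
  (fun a => conj_class (stab (p:=d.+3) (q:=e.+2) (f a)))) => [a|a a'].
  exists (stab (f a)) => //; split; last exact: stab_nonparabolic.
  apply: stab_maximal => // D.
  by apply: rotation_primitive => n; exact: spread_aperiodic.
move=> same; have [j] := @conj_class_stab d.+3 e.+2 _ _ isT isT
  (fq a) (fp a) (fq a') (fp a') same.
by move=> /rotation_translate_inj aa' n; rewrite (spread_inj aa').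
Qed.
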